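(* Let $R=[a_1,b_1]\times[a_2,b_2]$, $c\in(a_1,b_1]$, $R_1=[a_1,c]\times[a_2,b_2]$, and let $f\in V_c(R)$. Then $$E(f,R)=L(f,R_1)=\tfrac14\big[f(a_1,a_2)+f(c,b_2)-f(a_1,b_2)-f(c,a_2)\big].$$ Moreover, let $y_0\in[a_2,b_2]$ be any solution $y$ of the equation $$L(f,Y)=\tfrac12L(f,R_1),\qquad Y=[a_1,c]\times[a_2,y].$$ Then the function $\varphi_0(x)+\psi_0(y)$, where $$\varphi_0(x)=f(x,y_0),\qquad\psi_0(y)=\tfrac12\big[f(a_1,y)+f(c,y)-f(a_1,y_0)-f(c,y_0)\big],$$ is a best approximating sum to $f$, i.e. $\max_{(x,y)\in R}|f(x,y)-\varphi_0(x)-\psi_0(y)|=E(f,R)$.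
   Context: For a rectangle $S=[x_1,x_2]\times[y_1,y_2]\subset R$ put $$L(f,S)=\tfrac14[f(x_1,y_1)+f(x_2,y_2)-f(x_1,y_2)-f(x_2,y_1)].$$ With $R_2=[c,b_1]\times[a_2,b_2]$, a continuous function $f:R\to\mathbb{R}$ belongs to the class $V_c(R)$ if: 1) $L(f,S)\ge0$ for each such rectangle $S\subset R_1$; 2) $L(f,S)\le0$ for each such rectangle $S\subset R_2$; 3) $L(f,S)\ge0$ for each $S=[a_1,b_1]\times[y_1,y_2]\subset R$. $E(f,R)=\inf\max_{(x,y)\in R}|f(x,y)-\varphi(x)-\psi(y)|$, the infimum being over all $\varphi\in C[a_1,b_1]$, $\psi\in C[a_2,b_2]$. *)

(* Defs.v *)
From mathcomp Require Import all_boot all_order all_algebra.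
From mathcomp Require Import all_classical all_reals all_analysis.

Set Implicit Arguments.
Unset Strict Implicit.
Unset Printing Implicit Defensive.

Import Order.TTheory GRing.Theory Num.Theory.
Import numFieldNormedType.Exports.

Local Open Scope classical_set_scope.
Local Open Scope ring_scope.

(** [rect x1 x2 y1 y2] is [x1, x2] x [y1, y2]. *)
Definition rect (R : realType) (x1 x2 y1 y2 : R) : set (R * R) :=
  `[x1, x2] `*` `[y1, y2].

(** L(f, S) for S = [x1, x2] x [y1, y2], which may be degenerate. *)
Definition L (R : realType) (f : R * R -> R) (x1 x2 y1 y2 : R) : R :=
  4^-1 * (f (x1, y1) + f (x2, y2) - f (x1, y2) - f (x2, y1)).

(** The class V_c of the rectangle [a1, b1] x [a2, b2].  [f] is a total
    function, but only its restriction to the rectangle is constrained.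
    When c = b1 the second sign condition is vacuous. *)
Definition V (R : realType) (c a1 b1 a2 b2 : R) (f : R * R -> R) : Prop :=
  [/\ {within rect a1 b1 a2 b2, continuous f},
      forall x1 x2 y1 y2 : R, x1 < x2 -> y1 < y2 ->
        rect x1 x2 y1 y2 `<=` rect a1 c a2 b2 -> 0 <= L f x1 x2 y1 y2,
      forall x1 x2 y1 y2 : R, x1 < x2 -> y1 < y2 ->
        rect x1 x2 y1 y2 `<=` rect c b1 a2 b2 -> L f x1 x2 y1 y2 <= 0 &
      forall y1 y2 : R, y1 < y2 ->
        rect a1 b1 y1 y2 `<=` rect a1 b1 a2 b2 -> 0 <= L f a1 b1 y1 y2].

Definition is_max (R : realType) (A : set R) (m : R) : Prop :=
  A m /\ ubound A m.

Definition deviations (R : realType) (a1 b1 a2 b2 : R) (f : R * R -> R)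
    (phi psi : R -> R) : set R :=
  [set `|f p - phi p.1 - psi p.2| | p in rect a1 b1 a2 b2].

(** E(f, [a1, b1] x [a2, b2]).  For continuous [f], [phi], [psi] the maximum
    exists by compactness, so every admissible pair contributes exactly one
    element to the set. *)
Definition E (R : realType) (f : R * R -> R) (a1 b1 a2 b2 : R) : R :=
  inf [set m | exists phi psi : R -> R,
    [/\ {within `[a1, b1], continuous phi},
        {within `[a2, b2], continuous psi} &
        is_max (deviations a1 b1 a2 b2 f phi psi) m]].

(** phi(x) + psi(y) is a best approximating sum to f. *)
Definition best_approx (R : realType) (a1 b1 a2 b2 : R) (f : R * R -> R)
    (phi psi : R -> R) : Prop :=
  [/\ {within `[a1, b1], continuous phi},
      {within `[a2, b2], continuous psi} &
      is_max (deviations a1 b1 a2 b2 f phi psi) (E f a1 b1 a2 b2)].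

(* Main.v *)
(** The mixed difference [L] annihilates [phi(x) + psi(y)], so [L(f, R_1)] is a
    mean of four signed deviations at the vertices of [R_1]: this bounds
    [E(f, R)] from below.  For the upper bound write [D u v] for four times [L]
    on [[u, v]] x [[y0, y]]; the deviation of the proposed sum at [(x, y)] is
    [(D a1 x + D c x) / 2].  The sign conditions put it between
    [- D a1 c / 2] and [D a1 c / 2], and monotonicity in [y] together with the
    equation for [y0] gives [|D a1 c| / 2 <= L(f, R_1)]. *)
Require Import Defs.
From mathcomp Require Import all_boot all_order all_algebra.
From mathcomp Require Import all_classical all_reals all_analysis.
From mathcomp Require Import ring lra.

Import Order.TTheory GRing.Theory Num.Theory.
Import numFieldNormedType.Exports.

Local Open Scope classical_set_scope.
Local Open Scope ring_scope.

Lemma rect_in (R : realType) (x1 x2 y1 y2 x y : R) :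
  x1 <= x -> x <= x2 -> y1 <= y -> y <= y2 -> rect x1 x2 y1 y2 (x, y).
Proof. by move=> ? ? ? ?; split; rewrite /= in_itv /=; apply/andP. Qed.

Lemma rect_sub (R : realType) (x1 x2 y1 y2 u1 u2 v1 v2 : R) :
  x1 <= u1 -> u2 <= x2 -> y1 <= v1 -> v2 <= y2 ->
  rect u1 u2 v1 v2 `<=` rect x1 x2 y1 y2.
Proof.
move=> xu ux yv vy [x y] [/=]; rewrite !in_itv /= => /andP[? ?] /andP[? ?].
by apply: rect_in; lra.
Qed.

Lemma L_degenerate_l (R : realType) (f : R * R -> R) (x y1 y2 : R) :
  L f x x y1 y2 = 0.
Proof. rewrite /L; ring. Qed.

Lemma L_degenerate_r (R : realType) (f : R * R -> R) (x1 x2 y : R) :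
  L f x1 x2 y y = 0.
Proof. rewrite /L; ring. Qed.

(** Used with [g] a horizontal or vertical embedding of a segment, as [f] is continuous only within
    the rectangle. *)
Lemma within_continuous_comp (T U W : topologicalType) (A : set T) (B : set U)
    (g : T -> U) (f : U -> W) :
  continuous g -> (forall x, A x -> B (g x)) ->
  {within B, continuous f} -> {within A, continuous (f \o g)}.
Proof.
move=> cg gAB /subspace_continuousP cf; apply/subspace_continuousP => x Ax.
apply: (cvg_trans _ (cf _ (gAB _ Ax))) => P /= BP.
have {}BP : nbhs (g x) [set z | B z -> P (f z)] by exact: BP.
have := cg x _ BP; rewrite /nbhs /= => gP.
rewrite /within /=; near=> z => Az.
have : B (g z) -> P (f (g z)) by near: z; exact: gP.
by apply; exact: gAB.
Unshelve. all: by end_near. Qed.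

Section ClassV.
Variables (R : realType) (a1 b1 a2 b2 c : R) (f : R * R -> R).
Hypotheses (ha1c : a1 < c) (hcb1 : c <= b1) (ha2b2 : a2 < b2).
Hypothesis hf : V c a1 b1 a2 b2 f.

(** Degenerate rectangles, where [L] vanishes, are included so that later estimates may let sides
    collapse. *)
Lemma V_left_ge0 u v p q : a1 <= u -> u <= v -> v <= c ->
  a2 <= p -> p <= q -> q <= b2 -> 0 <= L f u v p q.
Proof.
move=> au; rewrite le_eqVlt => /predU1P[->|uv] vc ap.
  by rewrite L_degenerate_l.
rewrite le_eqVlt => /predU1P[->|pq] qb; first by rewrite L_degenerate_r.
by case: hf => _ + _ _; apply => //; exact: rect_sub.
Qed.

Lemma V_right_le0 u v p q : c <= u -> u <= v -> v <= b1 ->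
  a2 <= p -> p <= q -> q <= b2 -> L f u v p q <= 0.
Proof.
move=> au; rewrite le_eqVlt => /predU1P[->|uv] vc ap.
  by rewrite L_degenerate_l.
rewrite le_eqVlt => /predU1P[->|pq] qb; first by rewrite L_degenerate_r.
by case: hf => _ _ + _; apply => //; exact: rect_sub.
Qed.

Lemma V_full_ge0 p q : a2 <= p -> p <= q -> q <= b2 -> 0 <= L f a1 b1 p q.
Proof.
move=> ap; rewrite le_eqVlt => /predU1P[->|pq] qb.
  by rewrite L_degenerate_r.
by case: hf => _ _ _ h; apply: (h _ _ pq); exact: rect_sub.
Qed.

Lemma V_continuous_x y : a2 <= y -> y <= b2 ->
  {within `[a1, b1], continuous (fun x => f (x, y))}.
Proof.
move=> ay yb; case: hf => cf _ _ _.
apply: (@within_continuous_comp _ _ _ _ (rect a1 b1 a2 b2)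
  (fun x => (x, y)) f) => //.
  by move=> x; apply: (@cvg_pair _ _ _ _ (nbhs x) (nbhs y));
    [exact: cvg_id | exact: cvg_cst].
by move=> x /=; rewrite in_itv /= => /andP[? ?]; exact: rect_in.
Qed.

Lemma V_continuous_y x : a1 <= x -> x <= b1 ->
  {within `[a2, b2], continuous (fun y => f (x, y))}.
Proof.
move=> ax xb; case: hf => cf _ _ _.
apply: (@within_continuous_comp _ _ _ _ (rect a1 b1 a2 b2)
  (fun y => (x, y)) f) => //.
  by move=> y; apply: (@cvg_pair _ _ _ _ (nbhs x) (nbhs y));
    [exact: cvg_cst | exact: cvg_id].
by move=> y /=; rewrite in_itv /= => /andP[? ?]; exact: rect_in.
Qed.

Lemma L_le_max_deviation (phi psi : R -> R) m :
  is_max (deviations a1 b1 a2 b2 f phi psi) m -> L f a1 c a2 b2 <= m.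
Proof.
have [ac ab] := (ltW ha1c, ltW ha2b2); have a1b1 := le_trans ac hcb1.
move=> [_ ubm].
have dev x y : a1 <= x -> x <= b1 -> a2 <= y -> y <= b2 ->
    `|f (x, y) - phi x - psi y| <= m.
  by move=> *; apply: ubm; exists (x, y) => //; exact: rect_in.
(* Upper bounds at the two vertices that [L] counts with a plus sign, lower bounds at the other
   two. *)
have /ler_normlP[_ h1] := dev a1 a2 (lexx _) a1b1 (lexx _) ab.
have /ler_normlP[_ h2] := dev c b2 ac hcb1 ab (lexx _).
have /ler_normlP[h3 _] := dev a1 b2 (lexx _) a1b1 ab (lexx _).
have /ler_normlP[h4 _] := dev c a2 ac hcb1 (lexx _) ab.
rewrite /L; lra.
Qed.

Lemma exists_bisecting_y : exists2 y0 : R, y0 \in `[a2, b2] &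
  L f a1 c a2 y0 = 2^-1 * L f a1 c a2 b2.
Proof.
have [ac ab] := (ltW ha1c, ltW ha2b2); have a1b1 := le_trans ac hcb1.
apply: IVT => //; last first.
  (* As a function of [y], the left side is 0 at [a2] and the full, nonnegative value at [b2], so
     half of that value lies between. *)
  have := V_left_ge0 _ _ _ _ (lexx a1) ac (lexx c) (lexx a2) ab (lexx b2).
  rewrite L_degenerate_r => L0.
  by rewrite min_l // max_r //; apply/andP; split; lra.
move=> y; rewrite /L; apply: cvgMr.
apply: cvgB; last exact: cvg_cst.
apply: cvgB; last exact: V_continuous_y.
by apply: cvgD; [exact: cvg_cst | exact: V_continuous_y].
Qed.

Section BestSum.
Variable y0 : R.
Hypotheses (hy0 : y0 \in `[a2, b2])
  (hL : L f a1 c a2 y0 = 2^-1 * L f a1 c a2 b2).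

Let phi0 x := f (x, y0).
Let psi0 y := 2^-1 * (f (a1, y) + f (c, y) - f (a1, y0) - f (c, y0)).

Lemma psi0_continuous : {within `[a2, b2], continuous psi0}.
Proof.
have ac := ltW ha1c; have a1b1 := le_trans ac hcb1.
move=> y; apply: cvgMr.
apply: cvgB; last exact: cvg_cst.
apply: cvgB; last exact: cvg_cst.
by apply: cvgD; exact: V_continuous_y.
Qed.

Lemma max_deviation_phi0_psi0 :
  is_max (deviations a1 b1 a2 b2 f phi0 psi0) (L f a1 c a2 b2).
Proof.
have [ac ab] := (ltW ha1c, ltW ha2b2); have a1b1 := le_trans ac hcb1.
have /andP[ay yb] : a2 <= y0 <= b2 by move: hy0; rewrite in_itv.
have L0 := V_left_ge0 _ _ _ _ (lexx a1) ac (lexx c) (lexx a2) ab (lexx b2).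
move: hL; rewrite /phi0 /psi0 => hL'; split.
  (* At this vertex the signed deviation is [- 2 * L f a1 c y0 b2], which [hL] turns into
     [- L f a1 c a2 b2]. *)
  exists (a1, b2); first exact: rect_in.
  rewrite -[RHS]ger0_norm // -[RHS]normrN /=; congr (`|_|).
  by move: hL'; rewrite /L; lra.
move=> m [[x y] [/= + +] <-]; rewrite !in_itv /=.
move=> /andP[a1x xb1] /andP[a2y yb2].
(* Put d(u) = [f (u, q) - f (u, p)], so that [4 * L f u v p q] = d(v) - d(u). The claim says that
   d(x) lies between d(a1) and d(c). *)
have bound p q : a2 <= p -> p <= q -> q <= b2 ->
    `|f (x, q) - f (x, p) - 2^-1 *
      (f (a1, q) + f (c, q) - f (a1, p) - f (c, p))| <= 2 * L f a1 c p q.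
  move=> ap pq qb; have [xc|/ltW cx] := leP x c.
    have := V_left_ge0 _ _ _ _ (lexx a1) a1x xc ap pq qb.
    have := V_left_ge0 _ _ _ _ a1x xc (lexx c) ap pq qb.
    by rewrite ler_norml /L => ? ?; apply/andP; split; lra.
  (* Right of [c], d decreases, and the full-width condition keeps its final value above d(a1):
     d(a1) <= d(b1) <= d(x) <= d(c). *)
  have := V_right_le0 _ _ _ _ (lexx c) cx xb1 ap pq qb.
  have := V_right_le0 _ _ _ _ cx xb1 (lexx b1) ap pq qb.
  have := V_full_ge0 _ _ ap pq qb.
  by rewrite ler_norml /L => ? ? ?; apply/andP; split; lra.
(* The strip between [y0] and [y] lies in the upper or the lower part of [R_1] cut at [y0]. Each
   part carries half of [L f a1 c a2 b2], which cancels the factor 2 in [bound]. *)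
have [yy|/ltW yy] := leP y0 y.
  have := bound _ _ ay yy yb2.
  have := V_left_ge0 _ _ _ _ (lexx a1) ac (lexx c) a2y yb2 (lexx b2).
  by move: hL'; rewrite /L !ler_norml => ? ? /andP[? ?]; apply/andP; split; lra.
have := bound _ _ a2y yy yb.
have := V_left_ge0 _ _ _ _ (lexx a1) ac (lexx c) (lexx a2) a2y yb2.
by move: hL'; rewrite /L !ler_norml => ? ? /andP[? ?]; apply/andP; split; lra.
Qed.

End BestSum.

Lemma E_eq_L : E f a1 b1 a2 b2 = L f a1 c a2 b2.
Proof.
have [y0 hy0 hL] := exists_bisecting_y.
have /andP[ay yb] : a2 <= y0 <= b2 by move: hy0; rewrite in_itv.
rewrite /E; set S := [set m | _].
have lbL : lbound S (L f a1 c a2 b2).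
  by move=> m [phi [psi [_ _]]]; exact: L_le_max_deviation.
have memL : S (L f a1 c a2 b2).
  do 2 eexists; split; last exact: max_deviation_phi0_psi0 hy0 hL.
    exact: V_continuous_x.
  exact: psi0_continuous.
(* [inf] is a true infimum only on a nonempty set bounded below; the attained lower bound supplies
   both conditions. *)
apply/eqP; rewrite eq_le; apply/andP; split.
  by apply: ge_inf => //; exists (L f a1 c a2 b2).
by apply: lb_le_inf => //; exists (L f a1 c a2 b2).
Qed.

End ClassV.

Theorem theorem3p1 (R : realType) (a1 b1 a2 b2 c : R) (f : R * R -> R)
    (ha1c : a1 < c) (hcb1 : c <= b1) (ha2b2 : a2 < b2)
    (hf : V c a1 b1 a2 b2 f) :
  [/\ E f a1 b1 a2 b2 = L f a1 c a2 b2,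
      L f a1 c a2 b2 =
        4^-1 * (f (a1, a2) + f (c, b2) - f (a1, b2) - f (c, a2)) &
      forall y0 : R, y0 \in `[a2, b2] ->
        L f a1 c a2 y0 = 2^-1 * L f a1 c a2 b2 ->
        best_approx a1 b1 a2 b2 f
          (fun x => f (x, y0))
          (fun y => 2^-1 * (f (a1, y) + f (c, y) - f (a1, y0) - f (c, y0)))].
Proof.
have EL : E f a1 b1 a2 b2 = L f a1 c a2 b2 by exact: E_eq_L.
split=> // y0 hy0 hL; rewrite /best_approx EL.
have /andP[ay yb] : a2 <= y0 <= b2 by move: hy0; rewrite in_itv.
split.
- exact: (V_continuous_x _ _ _ _ _ _ _ hf).
- exact: (psi0_continuous _ _ _ _ _ _ _ ha1c hcb1 hf).
- exact: max_deviation_phi0_psi0.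
Qed.
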